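(* Let $M=\prod_{i=1}^Kp_i^{n_i}$. (i) Suppose $A,B\subset\mathbb{Z}_M$ and $A\oplus B=\mathbb{Z}_M$. Then for every $N\mid M$ and all $x,y\in\mathbb{Z}_M$, $$\langle\mathbb{A}^N[x],\mathbb{B}^N[y]\rangle=\frac{|A||B|}{N}=\frac{M}{N};$$ in particular $\langle\mathbb{A}^M[x],\mathbb{B}^M[y]\rangle=1$ for all $x,y\in\mathbb{Z}_M$. (ii) Conversely, if $A,B\subset\mathbb{Z}_M$ are sets with $|A||B|=M$ and $\langle\mathbb{A}^M[a],\mathbb{B}^M[b]\rangle=1$ for all $a\in A$, $b\in B$, then $A\oplus B=\mathbb{Z}_M$.
   Context: $p_1,\dots,p_K$ are distinct primes, $n_i\ge1$. $A\oplus B=\mathbb{Z}_M$ means every element of $\mathbb{Z}_M$ is uniquely $a+b$, $a\in A,b\in B$. For $N\mid M$, an $N$-box is a real array $\mathbb{A}=(\mathbb{A}_m)_{m\mid N}$ indexed by divisors of $N$; the box product of two $N$-boxes is $\langle\mathbb{A},\mathbb{B}\rangle=\sum_{m\mid N}\frac{1}{\phi(N/m)}\mathbb{A}_m\mathbb{B}_m$, $\phi$ Euler's totient. For $A\subset\mathbb{Z}_M$ and $N\mid M$, let $w_A^N(z)=\#\{a\in A:a\equiv z\bmod N\}$ for $z\in\mathbb{Z}_N$, and for $x\in\mathbb{Z}_M$ define the $N$-box $\mathbb{A}^N[x]$ by $\mathbb{A}^N_m[x]=\sum_{z\in\mathbb{Z}_N:\gcd(x-z,N)=m}w_A^N(z)$;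 in particular $\mathbb{A}^M_m[x]=\#\{a\in A:\gcd(x-a,M)=m\}$. Similarly for $B$. *)

(* Defs.v *)
From HB Require Import structures.
From mathcomp Require Import all_boot all_order all_algebra.

Set Implicit Arguments.
Unset Strict Implicit.
Unset Printing Implicit Defensive.

Import Order.TTheory GRing.Theory Num.Theory.

Local Open Scope ring_scope.

(* Z/nZ for n > 0, with the additive group structure of 'I_n.-1.+1.  The type
   'Z_n is not used because 'Z_1 is Z/2Z and the modulus N = 1 is needed. *)
Notation Zmod n := 'I_(n.-1.+1).

Definition tiles (M : nat) (A B : {set Zmod M}) : Prop :=
  forall z : Zmod M, exists! ab : Zmod M * Zmod M,
    [/\ ab.1 \in A, ab.2 \in B & ab.1 + ab.2 = z].

Notation divisor N := (seq_sub (divisors N)).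

Definition box (R : realFieldType) (N : nat) : Type := {ffun divisor N -> R}.

Definition box_prod (R : realFieldType) (N : nat) (U V : box R N) : R :=
  \sum_(m : divisor N) ((totient (N %/ val m))%:R)^-1 * U m * V m.

Definition weight (M N : nat) (A : {set Zmod M}) (z : Zmod N) : nat :=
  #|[set a in A | a == z %[mod N]]|.

(* The gcd is taken on integer representatives of x and z; for N dividing M it
   does not depend on their choice. *)
Definition box_at (R : realFieldType) (M N : nat) (A : {set Zmod M})
    (x : Zmod M) : box R N :=
  [ffun m : divisor N =>
    \sum_(z : Zmod N | gcdz (x%:Z - z%:Z) N%:Z == (val m)%:Z)
      (weight A z)%:R].

Lemma box_at_full (R : realFieldType) (M : nat) (A : {set Zmod M})
    (x : Zmod M) (m : divisor M) : (0 < M)%N ->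
  box_at R M A x m =
  #|[set a in A | gcdz (x%:Z - a%:Z) M%:Z == (val m)%:Z]|%:R.
Proof.
move=> M_gt0; rewrite ffunE -sum1_card natr_sum big_mkcond [RHS]big_mkcond /=.
apply: eq_bigr => z _; rewrite inE andbC; case: ifP => //= _.
have -> : weight A z = (z \in A).
  rewrite /weight; have eqz (a : Zmod M) : (a == z %[mod M]) = (a == z).
    by rewrite !modn_small // -{2}(prednK M_gt0) ltn_ord.
  case: (boolP (z \in A)) => Az.
    rewrite (_ : [set _ in _ | _] = [set z]) ?cards1 //.
    by apply/setP => a; rewrite !inE eqz andbC; case: eqP => // ->.
  apply/eqP; rewrite cards_eq0; apply/eqP/setP => a; rewrite !inE eqz.
  by case: eqP => [->|]; rewrite ?(negPf Az) ?andbF.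
by case: (z \in A).
Qed.

(* Main.v *)
(* Two residues s, t mod N have gcd(s, N) = gcd(t, N) = m exactly when some unit
   u satisfies u s = t, and then phi(M) / phi(N/m) of the units mod M do. Hence
   <A^N[x], B^N[y]> is the average, over the units u mod M, of the number of
   pairs (a, b) with u (x - a) = y - b mod N. By Tijdeman's theorem a tiling
   A + B = Z_M stays a tiling when A is multiplied by -u, so each of these
   numbers is M / N. For the converse, a in A and b in B already contribute 1
   through m = M, so a' - a and b - b' never share another gcd with M, which
   makes addition injective on A x B. *)
Require Import Defs.
From HB Require Import structures.
From mathcomp Require Import all_boot all_order all_algebra.
From mathcomp Require Import cyclic zify.

Set Implicit Arguments.
Unset Strict Implicit.
Unset Printing Implicit Defensive.

Import Order.TTheory GRing.Theory Num.Theory.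

Local Open Scope ring_scope.

(** * Polynomial arithmetic modulo ['X^M - 1] *)

Lemma sum_eqmod (M k : nat) : (0 < M)%N ->
  (\sum_(z < M) (k == z %[mod M]) = 1)%N.
Proof.
move=> M_gt0; rewrite (bigD1 (Ordinal (ltn_pmod k M_gt0))) //= modn_mod eqxx.
rewrite big1 ?addn0 // => z; rewrite -val_eqE /= (modn_small (ltn_ord z)).
by rewrite eq_sym => /negPf ->.
Qed.

Lemma modp_Xn_sub1 (F : fieldType) (M k : nat) : (0 < M)%N ->
  'X^k %% ('X^M - 1) = 'X^(k %% M) :> {poly F}.
Proof.
move=> M_gt0; apply/esym.
have [q Eq] : exists q : {poly F}, 'X^(k %/ M * M) - 1 = ('X^M - 1) * q.
  by rewrite mulnC exprM subrX1; eexists.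
apply: (@modpP _ _ ('X^(k %% M) * q)).
  rewrite {1}(divn_eq k M) exprD -mulrA [q * _]mulrC -Eq mulrBr mulr1 mulrC.
  by rewrite subrK.
by rewrite size_XnsubC // size_polyXn ltnS ltn_mod.
Qed.

(** [('X^k - 1)] times the sum equals [('X^M - 1) * \sum_(i < k) 'X^i], and the sum has degree below
    [M]. *)
Lemma modp_mul_geometric (F : fieldType) (M k : nat) : (0 < M)%N ->
  ('X^k * \sum_(z < M) 'X^z) %% ('X^M - 1) = \sum_(z < M) 'X^z :> {poly F}.
Proof.
move=> M_gt0; apply/esym.
apply: (@modpP _ _ (\sum_(i < k) 'X^i)).
  by rewrite subrX1 mulrA [_ * ('X - 1)]mulrC -subrX1 mulrBl mul1r subrK.
rewrite size_XnsubC // ltnS (leq_trans (size_sum _ _ _)) //.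
by apply/bigmax_leqP => z _; rewrite size_polyXn.
Qed.

(** * Tijdeman's theorem: multiplying one factor of a tiling by a unit *)

Section Tijdeman.

Variables (I J : finType) (A : {set I}) (B : {set J}) (g : J -> nat) (M : nat).
Hypothesis M_gt0 : (0 < M)%N.

(** The values of [f] and [g] are integers rather than residues: [f] can then be rescaled over a
    fixed index set [A], and the modulus [N] can vary. *)
Definition rep_count (f : I -> nat) (N z : nat) : nat :=
  \sum_(a in A) \sum_(b in B) (f a + g b == z %[mod N]).

Lemma sum_rep_count (f : I -> nat) :
  (\sum_(z < M) rep_count f M z = #|A| * #|B|)%N.
Proof.
rewrite exchange_big -sum_nat_const; apply: eq_bigr => a _.
rewrite exchange_big -sum1_card; apply: eq_bigr => b _.
exact: sum_eqmod.
Qed.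

(** Reducing exponents modulo [M] groups the pairs by the residue of [f a + g b], so the
    coefficients of the reduced product of mask polynomials are the counts. *)
Lemma modp_rep_count (F : fieldType) (f : I -> nat) :
  ((\sum_(a in A) 'X^(f a)) * (\sum_(b in B) 'X^(g b))) %% ('X^M - 1) =
  \sum_(z < M) (rep_count f M z)%:R *: 'X^z :> {poly F}.
Proof.
rewrite big_distrlr /= (big_morph _ (modpD _) (mod0p _)).
under [RHS]eq_bigr => z _ do
  rewrite natr_sum scaler_suml; rewrite exchange_big /=.
apply: eq_bigr => a _; rewrite (big_morph _ (modpD _) (mod0p _)).
under [RHS]eq_bigr => z _ do rewrite natr_sum scaler_suml.
rewrite exchange_big /=; apply: eq_bigr => b _.
rewrite -exprD modp_Xn_sub1 //.
rewrite (bigD1 (Ordinal (ltn_pmod (f a + g b) M_gt0))) //=.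
rewrite modn_mod eqxx scale1r big1 ?addr0 // => z.
rewrite -val_eqE /= (modn_small (ltn_ord z)).
by rewrite eq_sym => /negPf ->; rewrite scale0r.
Qed.

(* Modulo p, the mask polynomial of p f is the p-th power of that of f, and
   multiplying the all-ones polynomial by a mask only multiplies it by the
   number of monomials: every residue is represented by p f + g. *)
Lemma rep_count_mul_prime (f : I -> nat) (p : nat) :
  prime p -> coprime p M -> (forall z, rep_count f M z = 1%N) ->
  forall z, rep_count (fun a => p * f a)%N M z = 1%N.
Proof.
move=> p_pr p_M f1.
have cardAB : (#|A| * #|B| = M)%N.
  rewrite -(sum_rep_count f); under eq_bigr do rewrite f1.
  by rewrite sum1_card card_ord.
(* [#|A|] divides [M], which is prime to [p]. *)
have pA : (#|A|%:R != 0 :> 'F_p).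
  rewrite -(dvdn_pcharf (pchar_Fp p_pr)) -prime_coprime //.
  by apply: coprime_dvdr p_M; rewrite -cardAB dvdn_mulr.
pose P : {poly 'F_p} := \sum_(a in A) 'X^(f a).
pose Q : {poly 'F_p} := \sum_(b in B) 'X^(g b).
pose Phi : {poly 'F_p} := \sum_(z < M) 'X^z.
have PQ : (P * Q) %% ('X^M - 1) = Phi.
  by rewrite modp_rep_count; apply: eq_bigr => z _; rewrite f1 scale1r.
have PPhi k : (P ^+ k * Phi) %% ('X^M - 1) = #|A|%:R ^+ k *: Phi.
  elim: k => [|k IHk].
    by rewrite !expr0 scale1r -(expr0 'X) modp_mul_geometric.
  rewrite exprSr -mulrA -modp_mul mulr_suml (big_morph _ (modpD _) (mod0p _)).
  under eq_bigr do rewrite modp_mul_geometric //.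
  by rewrite sumr_const -scaler_nat -scalerAr modpZl IHk scalerA -exprS.
have pP : P ^+ p = \sum_(a in A) 'X^(p * f a).
  have pchP : p \in [pchar {poly 'F_p}] by rewrite pchar_poly pchar_Fp.
  rewrite -(pFrobenius_autE pchP) rmorph_sum /=; apply: eq_bigr => a _.
  by rewrite pFrobenius_autE mulnC exprM.
(* [P^p Q = P^(p-1) (P Q)] reduces to [#|A|^(p-1)] times [Phi], so each count is nonzero modulo [p],
   hence positive. *)
have cnt_gt0 (z : 'I_M) : (0 < rep_count (fun a => p * f a) M z)%N.
  have := modp_rep_count 'F_p (fun a => p * f a)%N.
  have -> : \sum_(a in A) 'X^(p * f a) = P ^+ p.-1 * P.
    by rewrite -exprSr prednK ?prime_gt0 // pP.
  rewrite -mulrA -modp_mul PQ PPhi.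
  move/(congr1 (fun q : {poly 'F_p} => q`_z)).
  rewrite coefZ.
  have Xz (c : 'I_M -> 'F_p) : \sum_(i < M) (c i *: 'X^i)`_z = c z.
    rewrite (bigD1 z) //= coefZ coefXn eqxx mulr1 big1 ?addr0 // => i.
    by rewrite -val_eqE coefZ coefXn eq_sym => /negPf ->; rewrite mulr0.
  have -> : Phi`_z = 1.
    by rewrite -(Xz (fun=> 1)) coef_sum; apply: eq_bigr => i _; rewrite scale1r.
  rewrite coef_sum Xz mulr1 lt0n => E; apply/eqP => cz0.
  by move/eqP: E; rewrite cz0 expf_eq0 (negPf pA) andbF.
(* [M] positive counts with total [M] are all equal to 1. *)
have cnt1 (z : 'I_M) : rep_count (fun a => p * f a)%N M z = 1%N.
  have [_] := leqif_sum (P := predT) (fun i _ => leqif_eq (cnt_gt0 i)).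
  move=> /esym; rewrite sum_rep_count cardAB sum1_card card_ord eqxx.
  by move=> /forallP/(_ z)/eqP.
move=> z; rewrite -(cnt1 (Ordinal (ltn_pmod z M_gt0))).
by apply: eq_bigr => a _; apply: eq_bigr => b _; rewrite /= modn_mod.
Qed.

Lemma eq_rep_count (f f' : I -> nat) (N z : nat) :
  (forall a, a \in A -> f a = f' a %[mod N]) ->
  rep_count f N z = rep_count f' N z.
Proof.
move=> eqf; apply: eq_bigr => a Aa; apply: eq_bigr => b _.
by rewrite -modnDml eqf // modnDml.
Qed.

(** Strong induction on [r] splits off one prime factor at a time, each prime to [M]. *)
Lemma rep_count_mul_coprime (f : I -> nat) (r : nat) :
  coprime r M -> (forall z, rep_count f M z = 1%N) ->
  forall z, rep_count (fun a => r * f a)%N M z = 1%N.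
Proof.
move=> + f1; elim/ltn_ind: r => r IHr r_M z.
(* [r = 0] is coprime to [M] only if [M = 1], where all integers are congruent. *)
have [r0|r_gt0] := posnP r.
  move: r_M; rewrite r0 /coprime gcd0n => /eqP M1.
  by rewrite -[RHS](f1 z) M1; apply: eq_rep_count => a _; rewrite !modn1.
have [r1|r_gt1] := leqP r 1.
  rewrite -[RHS](f1 z); apply: eq_rep_count => a _.
  by rewrite (_ : r = 1)%N ?mul1n //; apply/eqP; rewrite eqn_leq r1.
have p_pr := pdiv_prime r_gt1; have p_r := pdiv_dvd r.
have r_E : (pdiv r * (r %/ pdiv r) = r)%N by rewrite mulnC divnK.
rewrite (eq_rep_count (f' := fun a => pdiv r * (r %/ pdiv r * f a))%N).
  2: by move=> a _; rewrite mulnA r_E.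
apply: (@rep_count_mul_prime (fun a => r %/ pdiv r * f a)%N) => //.
  exact: coprime_dvdl r_M.
move=> z'; apply: IHr; first by rewrite ltn_Pdiv ?prime_gt1.
by apply: coprime_dvdl r_M; apply: dvdn_div.
Qed.

Lemma sum_eqmod_dvd (N z : nat) : (N %| M)%N ->
  (\sum_(w < M) (w == z %[mod N]) = M %/ N)%N.
Proof.
move=> N_M; have N_gt0 := dvdn_gt0 M_gt0 N_M.
have H q : (\sum_(w < q * N) (w == z %[mod N]) = q)%N.
  elim: q => [|q IHq]; first by rewrite big_ord0.
  rewrite mulSn big_split_ord /=.
  under [X in (_ + X)%N]eq_bigr do rewrite modnDl.
  rewrite IHq -[RHS]add1n; congr addn; rewrite -(sum_eqmod z N_gt0).
  by apply: eq_bigr => w _; rewrite eq_sym.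
by have := H (M %/ N)%N; rewrite divnK.
Qed.

(** A residue modulo [N] has [M %/ N] lifts modulo [M], each represented once. *)
Lemma rep_count_dvd (f : I -> nat) (N : nat) : (N %| M)%N ->
  (forall z, rep_count f M z = 1%N) ->
  forall z, rep_count f N z = (M %/ N)%N.
Proof.
move=> N_M f1 z; rewrite -(sum_eqmod_dvd z N_M).
transitivity (\sum_(w < M) rep_count f M w * (w == z %[mod N]))%N; last first.
  by apply: eq_bigr => w _; rewrite f1 mul1n.
under [RHS]eq_bigr do rewrite big_distrl; rewrite exchange_big /=.
apply: eq_bigr => a _; under [RHS]eq_bigr do rewrite big_distrl.
rewrite exchange_big /=; apply: eq_bigr => b _.
set k := (f a + g b)%N; rewrite -[LHS]mul1n -(sum_eqmod k M_gt0) big_distrl.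
apply: eq_bigr => w _ /=; have [kw|] := eqVneq; last by rewrite !mul0n.
by rewrite !mul1n -(modn_dvdm k N_M) kw modn_dvdm.
Qed.

End Tijdeman.

(** * Units modulo [M] acting on residues modulo [N] *)

Lemma coprime_lift (d M v : nat) : (0 < M)%N -> coprime v d ->
  exists2 u, coprime u M & u = v %[mod d].
Proof.
move=> M_gt0 v_d; pose k := (\prod_(q <- primes M | ~~ (q %| v)) q)%N.
(* Each prime of [M] divides exactly one of [v] and [k * d]: those missing [v] divide [k], those
   dividing [v] divide neither [k] nor [d]. So none divides the sum. *)
exists (v + k * d)%N; last by rewrite addnC modnMDl.
apply/eqP; set h := gcdn _ _.
have h_gt0 : (0 < h)%N by rewrite gcdn_gt0 M_gt0 orbT.
apply/eqP; rewrite eqn_leq h_gt0 andbT leqNgt; apply/negP => h_gt1.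
have l_pr := pdiv_prime h_gt1; have := pdiv_dvd h.
move: (pdiv h) l_pr => l l_pr; rewrite dvdn_gcd => /andP[l_u l_M].
have lM : l \in primes M by rewrite mem_primes l_pr M_gt0.
have [l_v|l_v] := boolP (l %| v)%N; last first.
  move/negP: (l_v); apply; rewrite -(dvdn_addl v (n := k * d)%N) //.
  by rewrite dvdn_mulr // /k (big_rem l lM) /= l_v dvdn_mulr.
move: l_u; rewrite dvdn_addr // Euclid_dvdM // => /orP[|l_d].
  rewrite /k big_seq_cond.
  elim/big_ind: _ => [|x y IHx IHy|q /andP[]].
  - by rewrite dvdn1 => /eqP l1; move: l_pr; rewrite l1.
  - by rewrite Euclid_dvdM // => /orP[].
  - rewrite mem_primes => /andP[q_pr _] q_v.
    by rewrite dvdn_prime2 // => /eqP lq; rewrite -lq l_v in q_v.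
have : (l %| gcdn v d)%N by rewrite dvdn_gcd l_v.
by rewrite (eqP v_d) dvdn1 => /eqP l1; move: l_pr; rewrite l1.
Qed.

Lemma unit_transitive (M N s t : nat) : (0 < M)%N -> (0 < N)%N ->
  gcdn s N = gcdn t N -> exists2 v, coprime v M & v * s = t %[mod N].
Proof.
move=> M_gt0 N_gt0; set m := gcdn s N => gt.
have m_gt0 : (0 < m)%N by rewrite gcdn_gt0 N_gt0 orbT.
have [s' s_E] := dvdnP (dvdn_gcdl s N); have [d N_E] := dvdnP (dvdn_gcdr s N).
have [t' t_E] := dvdnP (dvdn_gcdl t N); rewrite -gt -/m in s_E N_E t_E.
have cop c : gcdn (c * m) N = m -> coprime c d.
  by rewrite N_E -muln_gcdl -{2}[m]mul1n /coprime => /eqP; rewrite eqn_pmul2r.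
have s'_d : coprime s' d by apply: cop; rewrite -s_E.
have t'_d : coprime t' d by apply: cop; rewrite -t_E -gt.
have d_gt0 : (0 < d)%N by move: N_gt0; rewrite N_E muln_gt0 => /andP[].
(* By Euler's theorem [s' ^ (totient d).-1] inverts [s'] modulo [d], so [v] lifts the quotient of
   [t'] by [s']. *)
have [|v v_M vE] := @coprime_lift d M (s' ^ (totient d).-1 * t')%N M_gt0.
  by rewrite coprimeMl coprimeXl.
exists v => //; rewrite s_E t_E N_E mulnA -!muln_modl; congr muln.
rewrite -modnMml vE modnMml mulnAC -expnSr prednK ?totient_gt0 //.
by rewrite -modnMml Euler_exp_totient // modnMml mul1n.
Qed.

(** Multiplication by [m] is a bijection onto this set from the residues coprime to [N %/ m]. *)
Lemma card_gcd_eq (N m : nat) : (0 < N)%N -> (m %| N)%N ->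
  #|[set t : 'I_N | gcdn t N == m]| = totient (N %/ m).
Proof.
move=> N_gt0 m_N; have m_gt0 := dvdn_gt0 N_gt0 m_N.
have N_E : (N %/ m * m = N)%N by rewrite divnK.
have lt_mul (k : 'I_(N %/ m)) : (k * m < N)%N by rewrite -ltn_divRL.
have mul_inj : injective (fun k => Ordinal (lt_mul k)).
  by move=> k k' /(congr1 val)/eqP; rewrite /= eqn_pmul2r // => /eqP/val_inj.
have -> : totient (N %/ m) = #|[set k : 'I_(N %/ m) | coprime k (N %/ m)]|.
  rewrite totient_count_coprime big_mkord -sum1dep_card [RHS]big_mkcond.
  by apply: eq_bigr => k _; rewrite coprime_sym; case: (coprime _ _).
rewrite -(card_imset _ mul_inj); apply: eq_card => t; rewrite inE.
have gE c : (gcdn (c * m) N == m) = coprime c (N %/ m).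
  by rewrite -{1}N_E -muln_gcdl -[X in _ == X]mul1n eqn_pmul2r.
apply/idP/imsetP => [gt|[k + ->]]; last by rewrite inE /= gE.
have m_t : (m %| t)%N by rewrite -(eqP gt) dvdn_gcdl.
have t_lt : (t %/ m < N %/ m)%N by rewrite ltn_divRL // divnK.
exists (Ordinal t_lt); first by rewrite inE /= -gE divnK.
by apply: val_inj; rewrite /= divnK.
Qed.

Lemma eqn_modMr (w w' v M : nat) : coprime v M ->
  (w * v == w' * v %[mod M]) = (w == w' %[mod M]).
Proof.
move=> v_M; wlog le_w : w w' / (w' <= w)%N => [H|].
  by case/orP: (leq_total w' w) => /H // E; rewrite eq_sym E eq_sym.
by rewrite !eqn_mod_dvd ?leq_mul // -mulnBl Gauss_dvdl // coprime_sym.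
Qed.

Definition unit_count (M N s t : nat) : nat :=
  \sum_(u < M | coprime u M) (u * s == t %[mod N]).

(** The substitution of [u * v] for [u] permutes the units modulo [M]. *)
Lemma unit_count_mul (M N s t v : nat) : (0 < M)%N -> (N %| M)%N ->
  coprime v M -> unit_count M N s (v * t) = unit_count M N s t.
Proof.
move=> M_gt0 N_M v_M; pose h (u : 'I_M) := Ordinal (ltn_pmod (u * v) M_gt0).
have h_inj : injective h.
  move=> u u' /(congr1 val)/= /eqP; rewrite eqn_modMr //.
  by rewrite !modn_small // => /eqP/val_inj.
rewrite [LHS](reindex_inj h_inj); apply: eq_big => u /=.
  by rewrite coprime_modl coprimeMl v_M andbT.
move=> _; rewrite -modnMml modn_dvdm // modnMml mulnAC [(v * t)%N]mulnC.
by rewrite eqn_modMr // (coprime_dvdr N_M).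
Qed.

Lemma gcdn_mul_unit (M N u s t : nat) : (N %| M)%N -> coprime u M ->
  u * s = t %[mod N] -> gcdn s N = gcdn t N.
Proof.
move=> N_M u_M ust; rewrite -[gcdn t N]gcdn_modl -ust gcdn_modl.
rewrite gcdnC [gcdn (_ * _) _]gcdnC Gauss_gcdr //.
by rewrite coprime_sym (coprime_dvdr N_M).
Qed.

(** An orbit count: as [t'] runs over all residues modulo [N], the counts add up to [totient M];
    they vanish unless [t'] has the gcd of [s], and are equal on the [totient (N %/ gcdn s N)]
    residues that have it. *)
Lemma unit_count_gcd (M N s t : nat) : (0 < M)%N -> (N %| M)%N ->
  (unit_count M N s t * totient (N %/ gcdn s N) =
   (gcdn s N == gcdn t N) * totient M)%N.
Proof.
move=> M_gt0 N_M; have N_gt0 := dvdn_gt0 M_gt0 N_M.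
have [gst|gst] := eqVneq; last first.
  rewrite /unit_count big1 // => u u_M; apply/eqP; rewrite eqb0.
  by apply: contra gst => /eqP /(gcdn_mul_unit N_M u_M) ->.
rewrite mul1n -(card_gcd_eq N_gt0 (dvdn_gcdr s N)) mulnC -sum_nat_const.
transitivity (\sum_(t' < N) unit_count M N s t')%N; last first.
  rewrite exchange_big totient_count_coprime big_mkord big_mkcond.
  apply: eq_bigr => u _; rewrite coprime_sym; case: ifP => // _.
  exact: sum_eqmod.
rewrite big_mkcond; apply: eq_bigr => t' _; rewrite inE.
case: ifP => [/eqP gt'|gt'].
  have [v v_M /eqP vt] := unit_transitive M_gt0 N_gt0 (etrans gt' gst).
  rewrite -(unit_count_mul s t' M_gt0 N_M v_M).
  by apply: eq_bigr => u _; rewrite (eqP vt).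
rewrite /unit_count big1 // => u u_M; apply/eqP; rewrite eqb0.
by apply: contraFN gt' => /eqP /(gcdn_mul_unit N_M u_M) ->.
Qed.

(** * Boxes and tilings as counts over natural representatives *)

Lemma ltn_Zmod (M : nat) (a : Zmod M) : (0 < M)%N -> (a < M)%N.
Proof. by move=> M_gt0; rewrite -{2}(prednK M_gt0) ltn_ord. Qed.

Lemma Zmod_eqn_mod (M : nat) (a b : Zmod M) : (0 < M)%N ->
  (a == b %[mod M]) = (a == b).
Proof. by move=> M_gt0; rewrite !modn_small ?ltn_Zmod. Qed.

Lemma val_addZ (M : nat) (a b : Zmod M) : (0 < M)%N ->
  a + b = ((a + b)%N %% M)%N :> nat.
Proof. by case: M a b. Qed.

Lemma tiles_rep_count (M : nat) (A B : {set Zmod M}) : (0 < M)%N ->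
  tiles A B -> forall z, rep_count A B val val M z = 1%N.
Proof.
move=> M_gt0 tAB z.
have z_lt : (z %% M < M.-1.+1)%N by rewrite prednK // ltn_pmod.
have zE (a b : Zmod M) : (a + b == z %[mod M]) = (a + b == Ordinal z_lt).
  by rewrite -val_eqE [\val (a + b)]val_addZ.
have [[a0 b0] [[/= Aa Bb E] uniq_ab]] := tAB (Ordinal z_lt).
rewrite /rep_count pair_big /= (bigD1 (a0, b0)) /= ?Aa //.
rewrite (zE a0 b0) E eqxx big1 // => -[a b] /andP[/andP[/= Aa' Bb'] ab].
rewrite (zE a b); case: eqP => // E'; case/eqP: ab.
by rewrite (uniq_ab (a, b)).
Qed.

(** [x + (M - a)] represents [x - a] in [nat]: [a <= M] keeps the truncated subtraction exact, and
    the added [M] vanishes modulo [N]. *)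
Lemma gcdz_sub_rep (M N x a z : nat) : (N %| M)%N -> (a <= M)%N ->
  a = z %[mod N] -> gcdz (x%:Z - z%:Z) N%:Z = gcdn (x + (M - a)) N.
Proof.
move=> N_M le_aM az; rewrite -gcdz_modl.
have -> : ((x%:Z - z%:Z) %% N%:Z)%Z = ((x + (M - a))%N%:Z %% N%:Z)%Z.
  apply/eqP; rewrite eqz_mod_dvd PoszD -subzn //.
  have -> : x%:Z - z%:Z - (x%:Z + (M%:Z - a%:Z)) = (a%:Z - z%:Z) - M%:Z by lia.
  apply: rpredB; last by rewrite dvdzE.
  by rewrite -eqz_mod_dvd !modz_nat az.
by rewrite gcdz_modl.
Qed.

(** Each [a] enters the weight of exactly one residue, [a %% N], so the sum over residues becomes a
    sum over [A]. *)
Lemma box_atE (R : realFieldType) (M N : nat) (A : {set Zmod M})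
    (x : Zmod M) (m : divisor N) : (0 < M)%N -> (N %| M)%N ->
  box_at R N A x m =
  (\sum_(a in A) (gcdn (x + (M - a)) N == val m))%N%:R.
Proof.
move=> M_gt0 N_M; have N_gt0 := dvdn_gt0 M_gt0 N_M.
rewrite ffunE -natr_sum; congr _%:R.
under eq_bigr do rewrite /weight -sum1dep_card big_mkcondr.
rewrite exchange_big /=; apply: eq_bigr => a _.
have z_lt : (a %% N < N.-1.+1)%N by rewrite (prednK N_gt0) ltn_pmod.
have le_aM : (a <= M)%N by rewrite ltnW ?ltn_Zmod.
rewrite -big_mkcondr /= (eq_bigl (fun z =>
  (gcdn (x + (M - a)) N == val m) && (z == Ordinal z_lt))); last first.
  move=> z; rewrite -val_eqE /=.
  rewrite -[X in _ = _ && (X == _)](modn_small (ltn_Zmod z N_gt0)).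
  rewrite [X in _ = _ && X]eq_sym.
  have [az|] := eqVneq (a %% N)%N; rewrite ?andbF // !andbT.
  by rewrite (gcdz_sub_rep x N_M le_aM az).
case: (_ == val m); last by rewrite big_pred0_eq.
by rewrite big_pred1_eq.
Qed.

(** With [M.-1] standing for -1, this moves terms across [u (x - a) = y - b] to reach the form
    [f a + g b = z] of [rep_count]. *)
Lemma opp_eqn_mod (M N u x y a b : nat) : (0 < M)%N -> (N %| M)%N ->
    (a <= M)%N -> (b <= M)%N ->
  (u * (x + (M - a)) == y + (M - b) %[mod N]) =
  (u * M.-1 * a + b == y + u * M.-1 * x %[mod N]).
Proof.
move=> M_gt0 N_M le_a le_b.
(* The added term cancels the truncated subtractions and leaves, on each side, the target plus a
   multiple of [M]. *)
rewrite -(eqn_modDr (b + u * M.-1 * x + u * M * a)).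
have -> : (u * (x + (M - a)) + (b + u * M.-1 * x + u * M * a) =
           (u + u * x) * M + (u * M.-1 * a + b))%N by nia.
have -> : (y + (M - b) + (b + u * M.-1 * x + u * M * a) =
           (1 + u * a) * M + (y + u * M.-1 * x))%N by nia.
by case/dvdnP: N_M => q ->; rewrite !mulnA !modnMDl.
Qed.

(** Only [m = gcdn s N] can contribute, and [unit_count_gcd] evaluates that term. *)
Lemma sum_divisor_gcd (R : realFieldType) (M N s t : nat) : (0 < M)%N ->
    (N %| M)%N ->
  \sum_(m : divisor N) (totient (N %/ val m))%:R^-1 *
     (gcdn s N == val m)%:R * (gcdn t N == val m)%:R * (totient M)%:R
  = (unit_count M N s t)%:R :> R.
Proof.
move=> M_gt0 N_M; have N_gt0 := dvdn_gt0 M_gt0 N_M.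
have g_N : gcdn s N \in divisors N by rewrite -dvdn_divisors // dvdn_gcdr.
rewrite (bigD1 (SeqSub g_N)) //= eqxx big1 ?addr0 => [|m]; last first.
  by rewrite -val_eqE /= eq_sym => /negPf ->; rewrite mulr0 !mul0r.
have phi_neq0 : (totient (N %/ gcdn s N))%:R != 0 :> R.
  rewrite pnatr_eq0 -lt0n totient_gt0 divn_gt0 ?gcdn_gt0 ?N_gt0 ?orbT //.
  by rewrite dvdn_leq // dvdn_gcdr.
apply: (mulfI phi_neq0); rewrite mulr1 !mulrA divff // mul1r -!natrM.
by rewrite [in RHS]mulnC unit_count_gcd // eq_sym.
Qed.

Lemma box_prod_unit_count (R : realFieldType) (M N : nat) (A B : {set Zmod M})
    (x y : Zmod M) : (0 < M)%N -> (N %| M)%N ->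
  box_prod (box_at R N A x) (box_at R N B y) * (totient M)%:R =
  (\sum_(a in A) \sum_(b in B)
     unit_count M N (x + (M - a)) (y + (M - b)))%N%:R.
Proof.
move=> M_gt0 N_M; rewrite natr_sum mulr_suml.
under [RHS]eq_bigr => a _ do rewrite natr_sum.
under [RHS]eq_bigr => a _ do
  under eq_bigr => b _ do rewrite -sum_divisor_gcd //.
under [RHS]eq_bigr => a _ do rewrite exchange_big /=.
rewrite [RHS]exchange_big /=; apply: eq_bigr => m _.
rewrite !box_atE // !natr_sum mulr_sumr !mulr_suml.
rewrite [RHS]exchange_big /=; apply: eq_bigr => b _.
by rewrite mulr_sumr !mulr_suml.
Qed.

(** * From tilings to box products and back *)

Lemma tiles_box_prod (R : realFieldType) (M N : nat) (A B : {set Zmod M})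
    (x y : Zmod M) : (0 < M)%N -> (N %| M)%N -> tiles A B ->
  box_prod (box_at R N A x) (box_at R N B y) = M%:R / N%:R.
Proof.
move=> M_gt0 N_M tAB; have N_gt0 := dvdn_gt0 M_gt0 N_M.
have phiM_neq0 : (totient M)%:R != 0 :> R.
  by rewrite pnatr_eq0 -lt0n totient_gt0.
have -> : M%:R / N%:R = (M %/ N)%:R :> R.
  by rewrite -{1}(divnK N_M) natrM mulfK // pnatr_eq0 -lt0n.
apply: (mulIf phiM_neq0); rewrite box_prod_unit_count // -natrM; congr _%:R.
under eq_bigr do rewrite exchange_big; rewrite exchange_big /=.
(* With the units summed outermost, each of the [totient M] units is to contribute [M %/ N]. *)
transitivity (\sum_(u < M | coprime u M) (M %/ N))%N; last first.
  rewrite mulnC totient_count_coprime big_mkord big_distrl big_mkcond /=.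
  apply: eq_bigr => u _; rewrite coprime_sym.
  by case: (coprime _ _); rewrite ?mul1n ?mul0n.
apply: eq_bigr => u u_M.
(* [u * M.-1] represents [-u], the unit by which [A] is multiplied in Tijdeman's theorem. *)
have u_M' : coprime (u * M.-1) M by rewrite coprimeMl u_M coprimePn.
rewrite -(rep_count_dvd M_gt0 N_M
  (rep_count_mul_coprime M_gt0 u_M' (tiles_rep_count M_gt0 tAB))
  (y + u * M.-1 * x)).
apply: eq_bigr => a _; apply: eq_bigr => b _.
by rewrite opp_eqn_mod // ltnW // ltn_Zmod.
Qed.

Lemma tiles_card (M : nat) (A B : {set Zmod M}) : (0 < M)%N -> tiles A B ->
  (#|A| * #|B|)%N = M.
Proof.
move=> M_gt0 tAB; rewrite -(sum_rep_count A B val M_gt0 val).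
under eq_bigr do rewrite tiles_rep_count //.
by rewrite sum1_card card_ord.
Qed.

(* The divisor m = M contributes exactly 1, so no other divisor is the gcd of
   both differences. *)
Lemma box_prod1_eq (R : realFieldType) (M : nat) (A B : {set Zmod M})
    (a a' b b' : Zmod M) : (0 < M)%N ->
    a \in A -> a' \in A -> b \in B -> b' \in B ->
    box_prod (box_at R M A a) (box_at R M B b) = 1 ->
  a + b = a' + b' -> (a, b) = (a', b').
Proof.
move=> M_gt0 Aa Aa' Bb Bb' box1 eq_ab; have M_M := dvdnn M.
have ltM := ltn_Zmod _ M_gt0.
pose s := (a + (M - a'))%N; pose t := (b + (M - b'))%N.
(* [s] and [t] represent [a - a'] and [b - b']; equal sums make them opposite modulo [M], and -1 is
   a unit. *)
have g_eq : gcdn s M = gcdn t M.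
  apply: (gcdn_mul_unit (u := M.-1)) M_M _ _; first by rewrite coprimePn.
  apply/eqP; rewrite -(eqn_modDr (s + (a' + b'))).
  have -> : (M.-1 * s + (s + (a' + b')) = s * M + (a' + b'))%N by nia.
  have -> : (t + (s + (a' + b')) = 2 * M + (a + b))%N.
    by rewrite /s /t; have := ltM a'; have := ltM b'; lia.
  by rewrite !modnMDl -!val_addZ // eq_ab.
have box_ge (C : {set Zmod M}) (c c' : Zmod M) (m : divisor M) : c' \in C ->
    gcdn (c + (M - c')) M = val m -> 1 <= box_at R M C c m.
  move=> Cc' gm; rewrite box_atE // ler1n (bigD1 c') //= gm eqxx.
  by rewrite add1n.
have M_div : M \in divisors M by rewrite -dvdn_divisors.
have g_div : gcdn s M \in divisors M by rewrite -dvdn_divisors // dvdn_gcdr.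
have box_ge0 (C : {set Zmod M}) c (m : divisor M) : 0 <= box_at R M C c m.
  by rewrite box_atE // ler0n.
have g_M : gcdn s M = M.
  apply/eqP/negPn/negP => g_neq.
  have : 1 < box_prod (box_at R M A a) (box_at R M B b).
    (* The term at [M] is at least 1, as [a] and [b] count themselves; the one at [gcdn s M] is
       positive, as [a'] and [b'] count there. *)
    rewrite /box_prod (bigD1 (SeqSub M_div)) //= (bigD1 (SeqSub g_div)) //=.
    have gself (c : Zmod M) : gcdn (c + (M - c)) M = M.
      by rewrite subnKC ?gcdnn // ltnW.
    apply: ltr_pwDr; last first.
      rewrite divnn M_gt0 invr1 mul1r mulr_ege1 //.
        exact: (box_ge _ _ _ _ Aa).
      exact: (box_ge _ _ _ _ Bb).
    apply: ltr_pwDl; last first.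
      by apply: sumr_ge0 => m _; rewrite !mulr_ge0 ?invr_ge0 ?ler0n.
    rewrite !mulr_gt0 //.
    - rewrite invr_gt0 ltr0n totient_gt0 divn_gt0 ?gcdn_gt0 ?M_gt0 ?orbT //.
      by rewrite dvdn_leq // dvdn_gcdr.
    - by apply: lt_le_trans ltr01 _; apply: (box_ge _ _ _ _ Aa').
    - apply: lt_le_trans ltr01 _; apply: (box_ge _ _ _ _ Bb').
      by rewrite /= g_eq.
  by rewrite box1 ltxx.
have sub_eq (c c' : Zmod M) : gcdn (c + (M - c')) M = M -> c = c'.
  move=> gM; apply/eqP; rewrite -Zmod_eqn_mod // -(eqn_modDr (M - c')).
  rewrite subnKC ?modnn; last by rewrite ltnW.
  by have := dvdn_gcdl (c + (M - c')) M; rewrite gM.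
by rewrite (sub_eq a a') // (sub_eq b b') // -/t -g_eq.
Qed.

Lemma box_prod1_tiles (R : realFieldType) (M : nat) (A B : {set Zmod M}) :
    (0 < M)%N -> (#|A| * #|B|)%N = M ->
    (forall a b : Zmod M, a \in A -> b \in B ->
        box_prod (box_at R M A a) (box_at R M B b) = 1) ->
  tiles A B.
Proof.
move=> M_gt0 cardAB box1 z.
have add_inj :
    {in setX A B &, injective (fun ab : Zmod M * Zmod M => ab.1 + ab.2)}.
  move=> [a b] [a' b'] /setXP[Aa Bb] /setXP[Aa' Bb'] /=.
  exact: box_prod1_eq (box1 a b Aa Bb).
(* An injective image of [#|A| * #|B| = M] pairs fills all [M] residues. *)
have /setP/(_ z) : [set ab.1 + ab.2 | ab in setX A B] = setT.
  apply/eqP; rewrite eqEcard subsetT cardsT card_ord card_in_imset //.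
  by rewrite cardsX cardAB (prednK M_gt0) leqnn.
rewrite inE => /imsetP[ab ABab ->]; exists ab.
move: (ABab); rewrite inE => /andP[Aab Bab]; split=> // ab' [Aa' Bb' E].
by apply: add_inj => //; rewrite inE Aa'.
Qed.

Theorem mainTheorem3 (R : realFieldType) (K : nat) (p n : 'I_K -> nat)
    (p_prime : forall i, prime (p i)) (p_inj : injective p)
    (n_ge1 : forall i, (1 <= n i)%N)
    (M : nat) (M_def : M = (\prod_(i < K) p i ^ n i)%N) :
  (forall A B : {set Zmod M}, tiles A B ->
     (forall N : nat, (N %| M)%N -> forall x y : Zmod M,
        box_prod (box_at R N A x) (box_at R N B y)
          = #|A|%:R * #|B|%:R / N%:R
        /\ #|A|%:R * #|B|%:R / N%:R = M%:R / N%:R :> R)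
     /\ (forall x y : Zmod M,
           box_prod (box_at R M A x) (box_at R M B y) = 1))
  /\
  (forall A B : {set Zmod M}, (#|A| * #|B|)%N = M ->
     (forall a b : Zmod M, a \in A -> b \in B ->
        box_prod (box_at R M A a) (box_at R M B b) = 1) ->
     tiles A B).
Proof.
have M_gt0 : (0 < M)%N.
  by rewrite M_def prodn_gt0 // => i; rewrite expn_gt0 prime_gt0.
split=> A B; last exact: box_prod1_tiles.
move=> tAB; split=> [N N_M x y|x y]; last first.
  by rewrite tiles_box_prod // divff // pnatr_eq0 -lt0n.
by rewrite tiles_box_prod // -natrM tiles_card.
Qed.
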